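(* Let $p\ge 1$, $\ell\ge 2$, $m\ge 1$ be integers and let $(\mathbf y,\mathbf x)=(y_t,x_t)_{t\in\{1,\dots,m\}}$ be a sample with $y_t\in\mathbb R$, $x_t\in\mathbb R^{1\times p}$. Assume that the set $\{(y_t,x_t): t\in\{1,\dots,m\}\}\subset\mathbb R^{p+1}$ is not contained in a union of $\ell$ hyperplanes of dimension $p$. Let $\mathcal G$ be a compact subset of a Euclidean space and let $\mathbf\Gamma:\mathcal G\to[0,1]^{\ell\times\ell}$ be a continuous parametrization of the transition matrix, i.e. a continuous map taking values in the irreducible and aperiodic stochastic matrices. Let $(\mathbf\Theta,\mathcal T)$ be either of the parametrizations $(\mathbf\Theta^c,\mathcal T^c)$ (for some $c>0$; all error variances bounded below by $c$) or $(\mathbf\Theta^=,\mathcal T^=)$ (all error variances equal) defined in the context. Then the loglikelihood function $(\theta,\gamma)\mapsto \ell_{(\mathbf\Theta,\mathbf\Gamma)}(\mathbf y,\mathbf x\,|\,\theta,\gamma)$ of the linear Gaussian switching regression model attains its supremum on $\mathcal T\times\mathcal G$.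
   Context: Parametrizations of the regression matrix (a $(p+1)\times\ell$ matrix whose $j$th column is $(\beta_j,\sigma_j^2)\in\mathbb R^p\times(0,\infty)$): - For $c>0$, $\mathcal T^c=(\mathbb R^p\times[c,\infty))^\ell$ and $\mathbf\Theta^c_{ij}(\theta)=\theta_{(j-1)(p+1)+i}$ for $i\in\{1,\dots,p+1\}$, $j\in\{1,\dots,\ell\}$. - $\mathcal T^= =\mathbb R^{p\ell}\times(0,\infty)$ and $\mathbf\Theta^=_{ij}(\theta)=\theta_{(j-1)p+i}$ for $i\le p$, $\mathbf\Theta^=_{(p+1)j}(\theta)=\theta_{p\ell+1}$. Write $\beta_j(\theta)\in\mathbb R^p$ and $\sigma_j^2(\theta)>0$ for the $j$th regression coefficient and error variance, i.e. $(\beta_j(\theta),\sigma_j^2(\theta))$ is the $j$th column of $\mathbf\Theta(\theta)$. For $\gamma\in\mathcal G$, $\lambda(\gamma)\in\mathbb R^{1\times\ell}$ denotes the unique stationary distribution of the stochastic matrix $\mathbf\Gamma(\gamma)$. For $h=(h_1,\dots,h_m)\in\{1,\dots,\ell\}^m$ set $$p_{(\mathbf\Theta,\mathbf\Gamma)}(\mathbf y,\mathbf x,h\,|\,\theta,\gamma)=p(\mathbf x)\,\lambda(\gamma)_{h_1}\prod_{s=2}^m\mathbf\Gamma_{h_{s-1}h_s}(\gamma)\prod_{t=1}^m\mathcal N\big(y_t\,|\,x_t\beta_{h_t}(\theta),\sigma_{h_t}^2(\theta)\big),$$ where $\mathcal N(y\,|\,\mu,\sigma^2)$ is the density of the normal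 distribution with mean $\mu$ and variance $\sigma^2$ evaluated at $y$, and $p(\mathbf x)$ is the value at $\mathbf x$ of the (unspecified) density of the covariates, a factor not depending on $(\theta,\gamma)$. The loglikelihood function is $$\ell_{(\mathbf\Theta,\mathbf\Gamma)}(\mathbf y,\mathbf x\,|\,\theta,\gamma)=\log\sum_{h\in\{1,\dots,\ell\}^m}p_{(\mathbf\Theta,\mathbf\Gamma)}(\mathbf y,\mathbf x,h\,|\,\theta,\gamma).$$ *)

(* Defs.v *)
From HB Require Import structures.
From mathcomp Require Import all_boot all_order all_algebra.
From mathcomp Require Import all_classical all_reals all_analysis.
Set Implicit Arguments.
Unset Strict Implicit.
Unset Printing Implicit Defensive.
Import Order.TTheory GRing.Theory Num.Theory.
Import numFieldNormedType.Exports.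

Local Open Scope classical_set_scope.
Local Open Scope ring_scope.

Definition stochastic (R : realType) (l : nat) (P : 'M[R]_l) : Prop :=
  (forall i j, 0 <= P i j) /\ (forall i, \sum_j P i j = 1).

Definition irreducible_chain (R : realType) (l : nat) (P : 'M[R]_l) : Prop :=
  forall i j : 'I_l, exists2 n : nat, (0 < n)%N & 0 < (P ^+ n) i j.

(* The gcd of the set of return times of [i] is 1: its only common divisor
   is 1 (if the set is empty, every [d] divides its elements, so the condition
   fails). *)
Definition aperiodic_chain (R : realType) (l : nat) (P : 'M[R]_l) : Prop :=
  forall (i : 'I_l) (d : nat),
    (forall n : nat, (0 < n)%N -> 0 < (P ^+ n) i i -> (d %| n)%N) -> d = 1%N.

Definition stationary (R : realType) (l : nat) (P : 'M[R]_l) (v : 'rV[R]_l) :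
    Prop :=
  [/\ forall j, 0 <= v 0 j, \sum_j v 0 j = 1 & v *m P = v].

(* Meaningful only when [P] has exactly one stationary distribution, as is the
   case when [P] is stochastic and irreducible. *)
Definition stationary_distr (R : realType) (l : nat) (P : 'M[R]_l) : 'rV[R]_l :=
  xget 0 [set v | stationary P v].

(* A regression matrix is a (p + 1) x l matrix whose column j is made of the
   coefficient vector beta_j (the first p rows) and of the error variance
   sigma_j^2 (the last row). *)
Definition beta (R : realType) (p l : nat) (M : 'M[R]_(p + 1, l)) (j : 'I_l) :
    'cV[R]_p :=
  col j (usubmx M).

Definition sigma2 (R : realType) (p l : nat) (M : 'M[R]_(p + 1, l))
    (j : 'I_l) : R :=
  dsubmx M 0 j.

Lemma block_idx_subproof (l n : nat) (j : 'I_l) (i : 'I_n) :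
  (j * n + i < l * n)%N.
Proof.
have lt_in := ltn_ord i; have lt_jl := ltn_ord j.
apply: (@leq_trans (j.+1 * n)); last by rewrite leq_mul2r lt_jl orbT.
by rewrite mulSn addnC ltn_add2r.
Qed.

(* The position of the i-th coordinate of the j-th block in a vector made of l
   consecutive blocks of size n, with 0-based indices. *)
Definition block_idx (l n : nat) (j : 'I_l) (i : 'I_n) : 'I_(l * n) :=
  Ordinal (block_idx_subproof j i).

Definition Theta_c (R : realType) (p l : nat) (theta : 'rV[R]_(l * (p + 1))) :
    'M[R]_(p + 1, l) :=
  \matrix_(i, j) theta 0 (block_idx j i).

Definition T_c (R : realType) (p l : nat) (c : R) : set 'rV[R]_(l * (p + 1)) :=
  [set theta | forall j : 'I_l, c <= theta 0 (block_idx j (rshift p ord0))].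
Arguments T_c {R} p l c.

Definition Theta_eq (R : realType) (p l : nat) (theta : 'rV[R]_(l * p + 1)) :
    'M[R]_(p + 1, l) :=
  col_mx (\matrix_(i, j) theta 0 (lshift 1 (block_idx j i)))
         (const_mx (theta 0 (rshift (l * p) ord0))).

Definition T_eq (R : realType) (p l : nat) : set 'rV[R]_(l * p + 1) :=
  [set theta | 0 < theta 0 (rshift (l * p) ord0)].
Arguments T_eq R p l : clear implicits.

(* The sample (y_t, x_t) has size m.+1 and is indexed from 0; [dens] is the
   density of the covariates.  The second argument of [normal_pdf] is the
   standard deviation. *)
Definition complete_likelihood (R : realType) (p l m : nat)
    (dens : ('I_m.+1 -> 'rV[R]_p) -> R)
    (y : 'I_m.+1 -> R) (x : 'I_m.+1 -> 'rV[R]_p)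
    (h : {ffun 'I_m.+1 -> 'I_l}) (M : 'M[R]_(p + 1, l)) (P : 'M[R]_l) : R :=
  dens x * stationary_distr P 0 (h ord0)
  * \prod_(s < m) P (h (widen_ord (leqnSn m) s)) (h (lift ord0 s))
  * \prod_(t < m.+1)
      normal_pdf ((x t *m beta M (h t)) 0 0)
                 (Num.sqrt (sigma2 M (h t))) (y t).

(* Extended-real valued, so that the loglikelihood is -oo where the likelihood
   vanishes. *)
Definition loglikelihood (R : realType) (p l m k d : nat)
    (dens : ('I_m.+1 -> 'rV[R]_p) -> R)
    (Theta : 'rV[R]_k -> 'M[R]_(p + 1, l)) (Gamma : 'rV[R]_d -> 'M[R]_l)
    (y : 'I_m.+1 -> R) (x : 'I_m.+1 -> 'rV[R]_p)
    (theta : 'rV[R]_k) (gamma : 'rV[R]_d) : \bar R :=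
  lne (\sum_(h : {ffun 'I_m.+1 -> 'I_l})
         complete_likelihood dens y x h (Theta theta) (Gamma gamma))%:E.

Definition attains_sup (R : realType) (T : Type) (f : T -> \bar R) (A : set T) :
    Prop :=
  exists2 a, A a & f a = ereal_sup [set f b | b in A].

(* Hyperplanes are linear, i.e. p-dimensional subspaces of R^(p+1).  Affine
   hyperplanes would be too permissive: with an intercept among the covariates,
   all the points (y_t, x_t) lie in a single one. *)
Definition in_union_hyperplanes (R : realType) (p l m : nat)
    (y : 'I_m.+1 -> R) (x : 'I_m.+1 -> 'rV[R]_p) : Prop :=
  exists2 H : 'I_l -> {vspace 'rV[R]_(1 + p)},
    (forall j, \dim (H j) = p) &
    forall t, exists j, row_mx (y t)%:M (x t) \in H j.
Arguments in_union_hyperplanes {R p} l {m} y x.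

(* Main.v *)
(* If lambda = lambda P with P stochastic, then |lambda| is fixed by P too, so
   for P irreducible I - P + J (J the all-ones matrix) is invertible, the
   stationary distribution is (1 ... 1)(I - P + J)^-1, and it depends
   continuously on P.  It remains to find a compact set of parameters theta
   such that every other theta is dominated by one of them in each summand h.
   Coefficients: for some B, every b can be replaced by a b' with entries
   bounded by B and with no larger residual |y_t - x_t b'|; fix the values
   x_t b on the set of t where they are moderate and forget the others.
   Large variances are beaten by b = 0 with a fixed variance.
   Small common variance: for every b and every assignment h, some residual
   |y_t - x_t b_(h t)| is at least e > 0, since otherwise the data would lie in
   the l hyperplanes y = x b_j. *)

Require Import Defs.
From HB Require Import structures.
From mathcomp Require Import all_boot all_order all_algebra.
From mathcomp Require Import all_classical all_reals all_analysis.
From mathcomp Require Import ring lra.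
Import Order.TTheory GRing.Theory Num.Theory.
Import numFieldNormedType.Exports.
Local Open Scope classical_set_scope.
Local Open Scope ring_scope.

Set Implicit Arguments.
Unset Strict Implicit.

(** * Stationary distributions of irreducible stochastic matrices *)

(** Since [v] is fixed by every power of [P], a positive entry at [i] spreads to [j] through some
    [P ^+ n] whose [(i, j)] entry is positive. *)
Lemma irreducible_fixed_gt0 (R : realType) (l : nat) (P : 'M[R]_l)
  (v : 'rV[R]_l) :
  stochastic P -> irreducible_chain P ->
  (forall j, 0 <= v 0 j) -> v *m P = v -> v != 0 -> forall j, 0 < v 0 j.
Proof.
move=> [P_ge0 P_row] P_irr v_ge0 v_fix v_neq0 j.
have vX n : v *m (P ^+ n) = v.
  by elim: n => [|n IHn]; rewrite ?expr0 ?mulmx1// exprS -mulmxE mulmxA v_fix.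
have X_ge0 n a b : 0 <= (P ^+ n) a b.
  elim: n a b => [|n IHn] a b; first by rewrite expr0 mxE; case: eqP.
  by rewrite exprS -mulmxE mxE sumr_ge0// => i _; rewrite mulr_ge0.
have /rV0Pn[i vi] : v != 0 by [].
have [n _ Pn] := P_irr i j.
rewrite -(vX n) mxE (bigD1 i)//= ltr_pwDl//.
  by rewrite mulr_gt0// lt_def vi v_ge0.
by rewrite sumr_ge0// => a _; rewrite mulr_ge0.
Qed.

(** The triangle inequality gives |v| <= |v| P entrywise; both sides have the same total because the
    rows of [P] sum to 1, so equality holds in every entry. *)
Lemma abs_fixed (R : realType) (l : nat) (P : 'M[R]_l) (v : 'rV[R]_l) :
  stochastic P -> v *m P = v -> map_mx Num.norm v *m P = map_mx Num.norm v.
Proof.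
move=> [P_ge0 P_row] v_fix; set w := map_mx _ v.
have le_w j : w 0 j <= (w *m P) 0 j.
  rewrite mxE -{1}v_fix !mxE (le_trans (ler_norm_sum _ _ _))//.
  by apply: ler_sum => i _; rewrite normrM (ger0_norm (P_ge0 _ _)) mxE.
have sum_w : \sum_j ((w *m P) 0 j - w 0 j) = 0.
  rewrite sumrB; apply/eqP; rewrite subr_eq0; apply/eqP.
  under eq_bigr do rewrite mxE.
  rewrite exchange_big /=; apply: eq_bigr => i _.
  by rewrite -mulr_sumr P_row mulr1.
apply/rowP => j; apply/eqP; rewrite -subr_eq0; apply/eqP.
apply: (psumr_eq0P _ sum_w) => // i _.
by rewrite subr_ge0.
Qed.

Definition stationary_system (R : realType) (l : nat) (P : 'M[R]_l) : 'M[R]_l :=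
  1%:M - P + const_mx 1.

Lemma mul_const1 (R : realType) (l : nat) (v : 'rV[R]_l) :
  v *m (const_mx 1 : 'M[R]_l) = const_mx (\sum_j v 0 j).
Proof.
by apply/rowP => j; rewrite !mxE; apply: eq_bigr => i _; rewrite mxE mulr1.
Qed.

Lemma sum_mul_stochastic (R : realType) (l : nat) (P : 'M[R]_l) (v : 'rV[R]_l) :
  stochastic P -> \sum_j (v *m P) 0 j = \sum_j v 0 j.
Proof.
move=> [_ P_row]; under eq_bigr do rewrite mxE.
by rewrite exchange_big; apply: eq_bigr => i _; rewrite -mulr_sumr P_row mulr1.
Qed.

(** Summing the entries of the equation kills v - v P and leaves l times the total of [v] equal to l
    a; the constant rows then cancel. The value a = 1 describes normalized fixed rows, and a = 0 the
    kernel. *)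
Lemma mul_stationary_system (R : realType) (l : nat) (P : 'M[R]_l)
  (v : 'rV[R]_l) (a : R) : (0 < l)%N -> stochastic P ->
  v *m stationary_system P = const_mx a <-> \sum_j v 0 j = a /\ v *m P = v.
Proof.
move=> l_gt0 P_sto; rewrite /stationary_system mulmxDr mulmxBr mulmx1 mul_const1.
split=> [eq_a|[<- ->]]; last by rewrite subrr add0r.
have sum_v : \sum_j v 0 j = a.
  have : \sum_j (v - v *m P + const_mx (\sum_j v 0 j)) 0 j
      = \sum_(j < l) a.
    by rewrite eq_a; apply: eq_bigr => j _; rewrite mxE.
  under eq_bigr do rewrite !mxE.
  rewrite !big_split /= sumrN.
  have -> : \sum_j \sum_k v 0 k * P k j = \sum_j v 0 j.
    by rewrite -(sum_mul_stochastic v P_sto); apply: eq_bigr => j _; rewrite mxE.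
  rewrite subrr add0r !sumr_const card_ord => /eqP.
  by rewrite -subr_eq0 -mulrnBl mulrn_eq0 subr_eq0
    -[l == 0%N]negbK -lt0n l_gt0 => /eqP.
split=> //; move: eq_a; rewrite sum_v => /(canRL (addrK _)); rewrite subrr.
by move/subr0_eq.
Qed.

(** The row |v| - v is fixed and nonnegative, hence zero or positive everywhere. In the second case
    every entry of [v] is negative, against the sign of the sum. *)
Lemma fixed_row_ge0 (R : realType) (l : nat) (P : 'M[R]_l) (v : 'rV[R]_l) :
  stochastic P -> irreducible_chain P -> v *m P = v ->
  0 <= \sum_j v 0 j -> forall j, 0 <= v 0 j.
Proof.
move=> P_sto P_irr v_fix sum_ge0 j.
set w := map_mx Num.norm v.
have w_fix : w *m P = w by exact: abs_fixed.
have [wv0|wv_neq0] := eqVneq (w - v) 0.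
  by have /rowP/(_ j) := subr0_eq wv0; rewrite !mxE => <-.
have pos : forall i, 0 < (w - v) 0 i.
  apply: (irreducible_fixed_gt0 P_sto P_irr) => //.
    by move=> i; rewrite !mxE subr_ge0 ler_norm.
  by rewrite mulmxBl w_fix v_fix.
suff : \sum_i v 0 i < 0 by rewrite ltNge sum_ge0.
have neg i : v 0 i < 0.
  have := pos i; rewrite !mxE subr_gt0 => lt_v.
  by case: (lerP 0 (v 0 i)) => // v_ge0; rewrite ger0_norm ?ltxx in lt_v.
rewrite (bigD1 j)//= -[ltRHS]addr0 ltr_leD// sumr_le0// => i _.
by rewrite ltW.
Qed.

(** A row in the kernel is fixed by [P] and has sum 0; it is then nonnegative, so it vanishes. *)
Lemma stationary_system_unit (R : realType) (l : nat) (P : 'M[R]_l) :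
  (0 < l)%N -> stochastic P -> irreducible_chain P ->
  stationary_system P \in unitmx.
Proof.
move=> l_gt0 P_sto P_irr; rewrite -row_free_unit; apply/row_freeP.
suff : row_free (stationary_system P) by move/row_freeP.
rewrite -kermx_eq0; apply/eqP/row_matrixP => i; rewrite row0.
set v := row i _.
have : v *m stationary_system P = const_mx 0.
  by rewrite /v -row_mul mulmx_ker row0.
move=> /(mul_stationary_system v 0 l_gt0 P_sto)[sum_v v_fix].
have v_ge0 j : 0 <= v 0 j.
  by apply: fixed_row_ge0 P_sto P_irr v_fix _ _; rewrite sum_v.
by apply/rowP => j; rewrite [RHS]mxE; apply: (psumr_eq0P _ sum_v).
Qed.

Lemma stationary_distrE (R : realType) (l : nat) (P : 'M[R]_l) :
  (0 < l)%N -> stochastic P -> irreducible_chain P ->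
  stationary_distr P = const_mx 1 *m invmx (stationary_system P).
Proof.
move=> l_gt0 P_sto P_irr.
have U := stationary_system_unit l_gt0 P_sto P_irr.
rewrite /stationary_distr; set v := _ *m _.
apply: xget_unique.
  have /(mul_stationary_system v 1 l_gt0 P_sto)[sum_v v_fix] :
    v *m stationary_system P = const_mx 1 by rewrite mulmxKV.
  split=> // j; apply: fixed_row_ge0 P_sto P_irr v_fix _ _.
  by rewrite sum_v.
move=> w [_ sum_w w_fix]; apply/(canRL (mulmxK U)).
exact/(mul_stationary_system w 1 l_gt0 P_sto).
Qed.

Lemma stationary_distr_ge0 (R : realType) (l : nat) (P : 'M[R]_l) j :
  0 <= stationary_distr P 0 j.
(* The default value of [xget] is the zero row, which is nonnegative as well. *)
Proof. by rewrite /stationary_distr; case: xgetP => [v _ [->]|]; rewrite ?mxE. Qed.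

(** * Bounded coefficients with residuals that are no larger *)

(** Let [A] have row x_t for t in [S] and zero rows elsewhere, and let A' be its generalized
    inverse. Then b' = A' A b has the same values on [S], as A A' A = A, and depends linearly on
    these values alone. The witness [b'] does not depend on [M]. *)
Lemma interpolation_bound (R : realType) (p n : nat) (x : 'I_n -> 'rV[R]_p)
  (S : {set 'I_n}) :
  exists2 C : R, 0 <= C & forall b : 'cV[R]_p, exists b' : 'cV[R]_p,
    (forall M, 0 <= M -> (forall t, t \in S -> `|(x t *m b) 0 0| <= M) ->
       forall i, `|b' i 0| <= C * M) /\
    (forall t, t \in S -> (x t *m b') 0 0 = (x t *m b) 0 0).
Proof.
pose A : 'M[R]_(n, p) := \matrix_(t < n) (if t \in S then x t else 0).
have AE (c : 'cV[R]_p) t : (A *m c) t 0 = if t \in S then (x t *m c) 0 0 else 0.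
  have -> : (A *m c) t 0 = (row t A *m c) 0 0 by rewrite -row_mul [RHS]mxE.
  by rewrite rowK; case: ifP => // _; rewrite mul0mx mxE.
exists (\sum_i \sum_t `|pinvmx A i t|).
  by apply: sumr_ge0 => ? _; exact: sumr_ge0.
move=> b; exists (pinvmx A *m (A *m b)); split=> [M M_ge0 le_M i|t tS].
  rewrite mxE (le_trans (ler_norm_sum _ _ _))//.
  rewrite (@le_trans _ _ (\sum_t `|pinvmx A i t| * M))//.
    apply: ler_sum => t _; rewrite normrM ler_wpM2l// AE.
    by case: ifP => [/le_M|]; rewrite ?normr0.
  rewrite -mulr_suml ler_wpM2r// [leRHS](bigD1 i)//= lerDl.
  by apply: sumr_ge0 => ? _; exact: sumr_ge0.
have := AE (pinvmx A *m (A *m b)) t; rewrite tS => <-.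
by rewrite (mulmxA A (pinvmx A)) (mulmxA (A *m _) A) mulmxKpV// AE tS.
Qed.

(** Induction on the number of indices outside [S]. Either all values outside [S] exceed a threshold
    [D], and interpolating on [S] alone does no harm, or some index has a value at most [D] and can
    join [S] with a larger bound. *)
Lemma residual_domination_on (R : realType) (p n : nat) (y : 'I_n -> R)
  (x : 'I_n -> 'rV[R]_p) (S : {set 'I_n}) (M : R) : 0 <= M ->
  exists2 B : R, 0 <= B & forall b : 'cV[R]_p,
    (forall t, t \in S -> `|(x t *m b) 0 0| <= M) ->
    exists2 b' : 'cV[R]_p, (forall i, `|b' i 0| <= B) &
      forall t, `|y t - (x t *m b') 0 0| <= `|y t - (x t *m b) 0 0|.
Proof.
have [k leSk] := ubnP #|~: S|; elim: k S leSk M => // k IHk S leSk M M_ge0.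
have [C C_ge0 C_bound] := interpolation_bound x S.
(* One copy of |y_t| bounds the residual of the new coefficients from above, the other bounds the
   old residual from below. *)
pose D := \sum_t (\sum_i `|x t 0 i| * (C * M) + `|y t| *+ 2).
have term_ge0 t : 0 <= \sum_i `|x t 0 i| * (C * M) + `|y t| *+ 2.
  by rewrite addr_ge0 ?mulrn_wge0// sumr_ge0// => i _; rewrite !mulr_ge0.
have D_ge0 : 0 <= D by exact: sumr_ge0.
have le_D t : \sum_i `|x t 0 i| * (C * M) + `|y t| *+ 2 <= D.
  by rewrite /D (bigD1 t)//= lerDl sumr_ge0.
(* The induction hypothesis gives one bound for each index that may join [S]; indices already in [S]
   get the dummy bound 0, so that all bounds can be summed. *)
have /choice[B B_P] t : exists B : R, 0 <= B /\ (t \notin S ->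
    forall b : 'cV[R]_p,
    (forall s, s \in t |: S -> `|(x s *m b) 0 0| <= Num.max M D) ->
    exists2 b' : 'cV[R]_p, (forall i, `|b' i 0| <= B) &
      forall s, `|y s - (x s *m b') 0 0| <= `|y s - (x s *m b) 0 0|).
  have [tS|tS] := boolP (t \in S); first by exists 0.
  have [||B B_ge0 B_bound] := IHk (t |: S) _ (Num.max M D).
  - rewrite -ltnS (leq_trans _ leSk)// ltnS proper_card// properC.
    by rewrite properUr// finset.sub1set.
  - by rewrite le_max M_ge0.
  by exists B; split.
exists (C * M + \sum_t B t).
  by rewrite addr_ge0 ?mulr_ge0// sumr_ge0// => t _; case: (B_P t).
move=> b le_M.
(* Outside [S] the new residual is at most |y_t| + |x_t b'| <= D - |y_t| < |x_t b| - |y_t|, hence at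
   most the old one. *)
have [far|] := boolP [forall t, (t \notin S) ==> (D < `|(x t *m b) 0 0|)].
  have [b' [b'_le b'_eq]] := C_bound b.
  exists b' => [i|t].
    rewrite (le_trans (b'_le _ M_ge0 le_M i))// lerDl.
    by rewrite sumr_ge0// => t _; case: (B_P t).
  have [/b'_eq->//|tS] := boolP (t \in S).
  have := forallP far t; rewrite tS /= => lt_D.
  have xb'_le : `|(x t *m b') 0 0| <= \sum_i `|x t 0 i| * (C * M).
    rewrite mxE (le_trans (ler_norm_sum _ _ _))//; apply: ler_sum => i _.
    by rewrite normrM ler_wpM2l// b'_le.
  have := ler_normB (y t) ((x t *m b') 0 0).
  have := lerB_dist ((x t *m b) 0 0) (y t).
  rewrite (distrC _ (y t)).
  have := le_D t; rewrite mulr2n.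
  by move: (\sum_i _) xb'_le => s; lra.
rewrite negb_forall => /existsP[t]; rewrite negb_imply -leNgt => /andP[tS le_tD].
have [B_ge0 /(_ tS b)[s|b' b'_le b'_dom]] := B_P t.
  by rewrite !inE le_max => /orP[/eqP->|/le_M->//]; rewrite le_tD orbT.
exists b' => // i; rewrite (le_trans (b'_le i))// (bigD1 t)//= addrCA lerDl.
by rewrite addr_ge0 ?mulr_ge0// sumr_ge0// => s _; case: (B_P s).
Qed.

Lemma residual_domination (R : realType) (p n : nat) (y : 'I_n -> R)
  (x : 'I_n -> 'rV[R]_p) :
  exists2 B : R, 0 <= B & forall b : 'cV[R]_p,
    exists2 b' : 'cV[R]_p, (forall i, `|b' i 0| <= B) &
      forall t, `|y t - (x t *m b') 0 0| <= `|y t - (x t *m b) 0 0|.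
Proof.
have [B B_ge0 B_dom] := residual_domination_on y x finset.set0 (lexx 0).
by exists B => // b; apply: B_dom => t; rewrite inE.
Qed.

(** * Residuals of generic data stay away from zero *)

(** Without an exact fit, the row [z] of responses is outside the row space of [A], so some column
    of the cokernel of [A] pairs with [z] to a nonzero number. Subtracting any combination of the
    rows of [A] leaves this number unchanged, so the residuals cannot all be small. *)
Lemma fit_residual_gap (R : realType) (p n : nat) (y : 'I_n -> R)
  (x : 'I_n -> 'rV[R]_p) (S : {set 'I_n}) :
  ~ (exists b : 'cV[R]_p, forall t, t \in S -> y t = (x t *m b) 0 0) ->
  exists2 e : R, 0 < e & forall b : 'cV[R]_p,
    exists2 t, t \in S & e <= `|y t - (x t *m b) 0 0|.
Proof.
move=> no_fit.
pose A : 'M[R]_(p, n) := \matrix_(i, t) (if t \in S then x t 0 i else 0).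
pose z : 'rV[R]_n := \row_t (if t \in S then y t else 0).
have AE (c : 'rV_p) t : (c *m A) 0 t = if t \in S then (x t *m c^T) 0 0 else 0.
  rewrite !mxE; case: ifP => tS.
    by apply: eq_bigr => i _; rewrite !mxE tS mulrC.
  by rewrite big1// => i _; rewrite mxE tS mulr0.
have [/submxP[c zE]|] := boolP (z <= A)%MS.
  case: no_fit; exists c^T => t tS.
  by have /rowP/(_ t) := zE; rewrite AE mxE tS.
rewrite submxE => /rV0Pn[k]; set u := cokermx A => zu_neq0.
pose a := `|(z *m u) 0 k|; have a_gt0 : 0 < a by rewrite normr_gt0.
(* The added 1 makes [N] positive and the final inequality strict. *)
pose N := \sum_t `|u t k| + 1.
have N_gt0 : 0 < N by rewrite ltr_wpDl// sumr_ge0.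
exists (a / N); first by rewrite divr_gt0.
move=> b; apply: contrapT => far.
have small t : t \in S -> `|y t - (x t *m b) 0 0| < a / N.
  by move=> tS; rewrite ltNge; apply/negP => le_e; apply: far; exists t.
suff : a < a by rewrite ltxx.
rewrite {1}(_ : a = `|((z - b^T *m A) *m u) 0 k|); last first.
  by rewrite mulmxBl -mulmxA mulmx_coker mulmx0 subr0.
rewrite mxE (le_lt_trans (ler_norm_sum _ _ _))//.
rewrite (@le_lt_trans _ _ (\sum_t a / N * `|u t k|))//.
  apply: ler_sum => t _; rewrite normrM ler_wpM2r//.
  have -> : (z - b^T *m A) 0 t = z 0 t - (b^T *m A) 0 t.
    by rewrite [LHS]mxE [X in _ + X = _]mxE.
  rewrite AE trmxK mxE; case: ifP => [/small/ltW//|_].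
  by rewrite subr0 normr0 ltW// divr_gt0.
by rewrite -mulr_sumr mulrAC ltr_pdivrMr// ltr_pM2l// ltrDl.
Qed.

(** The graph is the image of an injective linear map on a space of dimension [p]. *)
Lemma graph_hyperplane (R : realType) (p : nat) (b : 'cV[R]_p) :
  exists2 H : {vspace 'rV[R]_(1 + p)}, \dim H = p &
    forall v : 'rV[R]_p, row_mx (v *m b) v \in H.
Proof.
pose f := linfun (mulmxr (row_mx b (1%:M : 'M[R]_p)) : 'rV[R]_p -> 'rV[R]_(1 + p)).
have fE v : f v = row_mx (v *m b) v by rewrite lfunE /= mul_mx_row mulmx1.
exists (limg f) => [|v]; last by rewrite -fE memv_img// memvf.
rewrite limg_dim_eq ?dimvf /dim/= ?mul1n//.
apply/eqP; rewrite -subv0; apply/subvP => v; rewrite memv_cap => /andP[_].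
by rewrite memv_ker fE => /eqP; rewrite -row_mx0 => /eq_row_mx[_ ->]; rewrite mem0v.
Qed.

(** If all residuals were below the gap of every subset without an exact fit, each class of [h]
    would have an exact fit [c j], possibly different from [b j], and the graphs of the [c j] would
    cover the data. *)
Lemma assignment_residual_gap (R : realType) (p l m : nat) (y : 'I_m.+1 -> R)
  (x : 'I_m.+1 -> 'rV[R]_p) :
  ~ in_union_hyperplanes l y x ->
  exists2 e : R, 0 < e &
    forall (h : {ffun 'I_m.+1 -> 'I_l}) (b : 'I_l -> 'cV[R]_p),
      exists t, e <= `|y t - (x t *m b (h t)) 0 0|.
Proof.
move=> generic.
pose fits (S : {set 'I_m.+1}) :=
  exists b : 'cV[R]_p, forall t, t \in S -> y t = (x t *m b) 0 0.
have /choice[e e_P] S : exists e : R, 0 < e /\ (~ fits S -> forall b : 'cV[R]_p,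
    exists2 t, t \in S & e <= `|y t - (x t *m b) 0 0|).
  have [?|/fit_residual_gap[e e_gt0 e_P]] := pselect (fits S); first by exists 1.
  by exists e; split.
(* There are finitely many index sets, so one gap serves all [h] and [b]; sets with an exact fit
   contribute the dummy value 1. *)
exists (\big[Num.min/1]_S e S).
  by apply/bigmin_gtP; split=> // S _; case: (e_P S).
move=> h b; apply: contrapT => no_gap; apply: generic.
have /choice[c c_P] j : fits (finset (fun t => h t == j)).
  apply: contrapT => nfit.
  have [_ /(_ nfit (b j))[t]] := e_P (finset (fun t => h t == j)).
  rewrite inE => /eqP <- le_e; apply: no_gap; exists t.
  by rewrite (le_trans _ le_e)// bigmin_le_cond.
have /choice[H H_P] j : exists H : {vspace 'rV[R]_(1 + p)}, \dim H = p /\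
    forall v : 'rV[R]_p, row_mx (v *m c j) v \in H.
  by have [H ? ?] := graph_hyperplane (c j); exists H.
exists H => [j|t]; first by case: (H_P j).
exists (h t); rewrite (_ : (y t)%:M = x t *m c (h t)); first by case: (H_P (h t)).
by rewrite [RHS]mx11_scalar -(c_P (h t)) ?inE.
Qed.

(** * Comparison of normal densities *)

Lemma ler_sqr_norm (R : realType) (a b : R) : `|a| <= `|b| -> a ^+ 2 <= b ^+ 2.
Proof.
move=> le_ab; rewrite -(ger0_norm (sqr_ge0 a)) -(ger0_norm (sqr_ge0 b)).
by rewrite !normrX lerXn2r ?nnegrE.
Qed.

Lemma normal_pdf_sqrtE (R : realType) (mu s y : R) : 0 < s ->
  normal_pdf mu (Num.sqrt s) y =
  (Num.sqrt (s * pi *+ 2))^-1 * expR (- (y - mu) ^+ 2 / (s *+ 2)).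
Proof.
move=> s_gt0; rewrite normal_pdfE ?gt_eqF ?sqrtr_gt0//.
by rewrite /normal_peak /normal_fun sqr_sqrtr// ltW.
Qed.

Lemma ler_normal_pdf_residual (R : realType) (mu mu' s y : R) : 0 < s ->
  `|y - mu'| <= `|y - mu| ->
  normal_pdf mu (Num.sqrt s) y <= normal_pdf mu' (Num.sqrt s) y.
Proof.
move=> s_gt0 le_res; rewrite !normal_pdf_sqrtE// ler_wpM2l ?invr_ge0 ?sqrtr_ge0//.
rewrite ler_expR !mulNr lerN2 ler_wpM2r ?invr_ge0 ?mulrn_wge0 ?(ltW s_gt0)//.
exact: ler_sqr_norm.
Qed.

Lemma normal_pdf_large_variance (R : realType) (c Y : R) : 0 < c ->
  exists2 S : R, c <= S & forall s mu y, S < s -> `|y| <= Y ->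
    normal_pdf mu (Num.sqrt s) y <= normal_pdf 0 (Num.sqrt c) y.
Proof.
move=> c_gt0; pose E := expR (Y ^+ 2 / (c *+ 2)).
have E_ge1 : 1 <= E.
  by rewrite -expR0 ler_expR divr_ge0 ?sqr_ge0 ?mulrn_wge0 ?ltW.
have E_gt0 : 0 < E := expR_gt0 _.
(* At this variance the peak of the density has fallen to the least value that the centred density
   of variance [c] takes on [-Y, Y]. *)
exists (c * E ^+ 2); first by rewrite ler_peMr ?(ltW c_gt0)// exprn_ege1.
move=> s mu y lt_s le_y.
have s_gt0 : 0 < s by rewrite (lt_trans _ lt_s)// mulr_gt0// exprn_gt0.
have pi_gt0 := @pi_gt0 R.
(* Moving the mean to [y] maximizes the left-hand side. *)
rewrite (@le_trans _ _ (normal_pdf y (Num.sqrt s) y))//.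
  by rewrite ler_normal_pdf_residual// subrr normr0.
rewrite !normal_pdf_sqrtE// subrr expr0n oppr0 mul0r expR0 mulr1 addr0.
have Q_gt0 : 0 < Num.sqrt (c * pi *+ 2).
  by rewrite sqrtr_gt0 mulrn_wgt0// mulr_gt0.
rewrite (@le_trans _ _ ((Num.sqrt (c * pi *+ 2))^-1 * E^-1))//.
  rewrite -invfM lef_pV2 ?posrE ?mulr_gt0 ?sqrtr_gt0 ?mulrn_wgt0 ?mulr_gt0//.
  rewrite -[X in _ * X](ger0_norm (ltW E_gt0)) -sqrtr_sqr -sqrtrM; last first.
    by rewrite mulrn_wge0// mulr_ge0// ltW.
  apply: ler_wsqrtr; rewrite mulrnAl lerMn2r /= mulrAC ler_wpM2r//; exact: ltW.
rewrite ler_wpM2l ?invr_ge0 ?(ltW Q_gt0)// -expRN ler_expR mulNr lerN2.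
rewrite ler_wpM2r ?invr_ge0 ?mulrn_wge0 ?(ltW c_gt0)//.
by rewrite ler_sqr_norm// (le_trans le_y)// ler_norm.
Qed.

(* The factor [exp (- e^2 / 2s)] of the residual bounded away from 0 beats
   [s ^ (- (n + 1) / 2)]: its [(n + 1)]-th root is at most [2 (n + 1) s / e^2]. *)
Lemma normal_pdf_small_variance (R : realType) (n : nat) (e Y : R) : 0 < e ->
  exists2 r : R, 0 < r & forall s (mu y : 'I_n.+1 -> R), 0 < s -> s < r ->
    (exists t, e <= `|y t - mu t|) -> (forall t, `|y t| <= Y) ->
    \prod_t normal_pdf (mu t) (Num.sqrt s) (y t)
      <= \prod_t normal_pdf 0 (Num.sqrt 1) (y t).
Proof.
move=> e_gt0; have pi_gt0 := @pi_gt0 R.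
pose Q : R := Num.sqrt (pi *+ 2).
have Q_gt0 : 0 < Q by rewrite sqrtr_gt0 mulrn_wgt0.
(* A lower bound for the standard normal density on [-Y, Y]. *)
pose k := Q^-1 * expR (- Y ^+ 2 / 2).
(* Chosen so that Num.sqrt s <= a gives q / Num.sqrt s <= exp (- Y^2 / 2), once [q] is bounded by 2
   (n + 1) s / e^2. *)
pose a := expR (- Y ^+ 2 / 2) * (e ^+ 2 / (n.+1%:R *+ 2)).
have a_gt0 : 0 < a.
  by rewrite mulr_gt0 ?expR_gt0// divr_gt0 ?exprn_gt0// mulrn_wgt0 ?ltr0n.
exists (a ^+ 2); first by rewrite exprn_gt0.
move=> s mu y s_gt0 lt_s [t0 le_e] le_Y.
have Qs : Num.sqrt (s * pi *+ 2) = Num.sqrt s * Q.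
  by rewrite -mulrnAr sqrtrM ?ltW.
pose q := expR (- (e ^+ 2 / (s *+ 2) / n.+1%:R)).
have qX : expR (- e ^+ 2 / (s *+ 2)) = q ^+ n.+1.
  by rewrite -expRM_natl; congr expR; field; rewrite nat1r pnatr_eq0/= gt_eqF.
have peak_ge0 : 0 <= (Num.sqrt s * Q)^-1.
  by rewrite invr_ge0 mulr_ge0// ?sqrtr_ge0// ltW.
have le_k : (Num.sqrt s * Q)^-1 * q <= k.
  rewrite invfM mulrC mulrA mulrC ler_wpM2l ?invr_ge0 ?(ltW Q_gt0)//.
  rewrite ler_pdivrMr ?sqrtr_gt0//.
  have sqrt_le : Num.sqrt s <= a.
    by rewrite -[leRHS](ger0_norm (ltW a_gt0)) -sqrtr_sqr ler_wsqrtr// ltW.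
  (* This is exp (- z) <= 1 / z, from 1 + z <= exp z. *)
  have q_le : q <= (e ^+ 2 / (s *+ 2) / n.+1%:R)^-1.
    have z_gt0 : 0 < e ^+ 2 / (s *+ 2) / n.+1%:R.
      by rewrite !divr_gt0 ?exprn_gt0 ?mulrn_wgt0 ?ltr0n.
    rewrite /q expRN lef_pV2 ?posrE ?expR_gt0//.
    by rewrite (le_trans _ (expR_ge1Dx _))// lerDr.
  apply: (le_trans q_le).
  have sq : Num.sqrt s ^+ 2 = s by rewrite sqr_sqrtr// ltW.
  have r_gt0 : 0 < Num.sqrt s by rewrite sqrtr_gt0.
  move: sqrt_le; rewrite /a; set E := expR _ => sqrt_le.
  have -> : (e ^+ 2 / (s *+ 2) / n.+1%:R)^-1
      = Num.sqrt s * ((n.+1%:R *+ 2) / e ^+ 2) * Num.sqrt s.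
    rewrite -{1}sq; field.
    by rewrite !gt_eqF ?ltr0n.
  rewrite ler_wpM2r ?sqrtr_ge0//.
  rewrite -ler_pdivlMr ?divr_gt0 ?exprn_gt0 ?mulrn_wgt0 ?ltr0n//.
  by rewrite invf_div.
have k_ge0 : 0 <= k by rewrite mulr_ge0 ?expR_ge0 ?invr_ge0 ?(ltW Q_gt0).
apply: (@le_trans _ _ (k ^+ n.+1)).
  apply: (@le_trans _ _ (((Num.sqrt s * Q)^-1 * q) ^+ n.+1)); last first.
    by rewrite lerXn2r// nnegrE mulr_ge0//; exact: expR_ge0.
  (* The factor at [t0] carries the whole exponential q^(n + 1); the other factors are bounded by
     the peak. *)
  rewrite exprMn exprS mulrAC -qX (bigD1 t0)//=.
  rewrite ler_pM ?prodr_ge0 ?normal_pdf_ge0//.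
  - by move=> i _; exact: normal_pdf_ge0.
  - rewrite normal_pdf_sqrtE// Qs ler_wpM2l// ler_expR !mulNr lerN2.
    rewrite ler_wpM2r ?invr_ge0 ?mulrn_wge0 ?(ltW s_gt0)//.
    by rewrite ler_sqr_norm// ger0_norm// ltW.
  have -> : (Num.sqrt s * Q)^-1 ^+ n = \prod_(i | i != t0) (Num.sqrt s * Q)^-1.
    by rewrite prodr_const cardC1 card_ord.
  apply: ler_prod => i _; rewrite normal_pdf_ge0 normal_pdf_sqrtE// Qs.
  rewrite ler_piMr// -[leRHS]expR0 ler_expR mulNr oppr_le0.
  by rewrite divr_ge0 ?sqr_ge0 ?mulrn_wge0 ?ltW.
have -> : k ^+ n.+1 = \prod_(i < n.+1) k by rewrite prodr_const card_ord.
apply: ler_prod => i _; rewrite k_ge0 normal_pdf_sqrtE// mul1r subr0.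
rewrite ler_wpM2l ?invr_ge0 ?(ltW Q_gt0)// ler_expR !mulNr lerN2.
rewrite ler_wpM2r ?invr_ge0//.
by rewrite ler_sqr_norm// (le_trans (le_Y i))// ler_norm.
Qed.

(** * Continuity of the stationary distribution and of the densities *)

Lemma cvg_det (R : realType) (T : Type) (F : set_system T) (n : nat)
  (A : T -> 'M[R]_n) (a : 'M[R]_n) : Filter F ->
  (forall i j, A t i j @[t --> F] --> a i j) ->
  \det (A t) @[t --> F] --> \det a.
Proof.
move=> FF A_a; rewrite /determinant.
apply: cvg_big => [|s _]; first exact: add_continuous.
apply: cvgM; first exact: cvg_cst.
by apply: cvg_big => [|i _]; [exact: mul_continuous|exact: A_a].
Qed.

(** Cramer's rule: the distribution is a rational function of the entries of [P] with nonzero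
    denominator, so limits can be taken entrywise. *)
Lemma stationary_distr_entry (R : realType) (l : nat) (P : 'M[R]_l) j :
  (0 < l)%N -> stochastic P -> irreducible_chain P ->
  stationary_distr P 0 j = (\det (stationary_system P))^-1 *
    \sum_i cofactor (stationary_system P) j i.
Proof.
move=> l_gt0 P_sto P_irr; rewrite stationary_distrE// /invmx.
rewrite stationary_system_unit// -scalemxAr mxE; congr (_ * _).
by rewrite mxE; apply: eq_bigr => i _; rewrite !mxE mul1r.
Qed.

Lemma cvg_stationary_distr (R : realType) (T : Type) (F : set_system T) (l : nat)
  (P : T -> 'M[R]_l) (a : 'M[R]_l) j : Filter F ->
  (0 < l)%N -> stochastic a -> irreducible_chain a ->
  (\forall t \near F, stochastic (P t) /\ irreducible_chain (P t)) ->
  (forall i j, P t i j @[t --> F] --> a i j) ->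
  stationary_distr (P t) 0 j @[t --> F] --> stationary_distr a 0 j.
Proof.
move=> FF l_gt0 a_sto a_irr P_si P_a.
have S_a i k : stationary_system (P t) i k @[t --> F] --> stationary_system a i k.
  rewrite /stationary_system !mxE; under eq_cvg do rewrite !mxE.
  by apply: cvgD; [apply: cvgB => //|]; exact: cvg_cst.
rewrite stationary_distr_entry//.
(* The rational formula is available only where [P t] is stochastic and irreducible, that is
   eventually along [F]. *)
apply: (@cvg_trans _ ((\det (stationary_system (P t)))^-1 *
    \sum_i cofactor (stationary_system (P t)) j i @[t --> F])).
  apply: near_eq_cvg; apply: filterS P_si => t [? ?].
  by rewrite stationary_distr_entry.
apply: cvgM.
  apply: cvgV; last exact: cvg_det.
  by have := stationary_system_unit l_gt0 a_sto a_irr; rewrite unitmxE unitfE.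
apply: cvg_big => [|i _]; first exact: add_continuous.
apply: cvgM; first exact: cvg_cst.
apply: cvg_det => i1 j1; rewrite 2!mxE; under eq_cvg do rewrite 2!mxE.
exact: S_a.
Qed.

Lemma cvg_normal_pdf (R : realType) (T : Type) (F : set_system T)
  (mu s : T -> R) (mu0 s0 y : R) : Filter F -> 0 < s0 ->
  mu t @[t --> F] --> mu0 -> s t @[t --> F] --> s0 ->
  normal_pdf (mu t) (Num.sqrt (s t)) y @[t --> F]
    --> normal_pdf mu0 (Num.sqrt s0) y.
Proof.
move=> FF s0_gt0 mu_mu0 s_s0.
have s_gt0 : \forall t \near F, 0 < s t by exact: cvgr_gt s_s0 _ s0_gt0.
have pi_gt0 := @pi_gt0 R.
rewrite normal_pdf_sqrtE//.
apply: (@cvg_trans _ ((Num.sqrt (s t * pi *+ 2))^-1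
    * expR (- (y - mu t) ^+ 2 / (s t *+ 2)) @[t --> F])).
  apply: near_eq_cvg; apply: filterS s_gt0 => t st_gt0.
  by rewrite normal_pdf_sqrtE.
apply: cvgM.
  apply: cvgV; first by rewrite gt_eqF// sqrtr_gt0 mulrn_wgt0// mulr_gt0.
  apply: cvg_comp; last exact: sqrt_continuous.
  by apply: cvgMn; apply: cvgM => //; exact: cvg_cst.
apply: cvg_comp; last exact: continuous_expR.
apply: cvgM.
  apply: cvgN; apply: (cvg_comp (fun t => y - mu t) (fun u : R => u ^+ 2));
    last exact: sqr_continuous.
  by apply: cvgB => //; exact: cvg_cst.
by apply: cvgV; [rewrite gt_eqF// mulrn_wgt0|exact: cvgMn].
Qed.

(** * Reduction to a dominating compact set of parameters *)

(** The factor of [complete_likelihood] through which the regression parameters enter. *)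
Definition emission (R : realType) (p l m : nat) (y : 'I_m.+1 -> R)
    (x : 'I_m.+1 -> 'rV[R]_p) (h : {ffun 'I_m.+1 -> 'I_l})
    (M : 'M[R]_(p + 1, l)) : R :=
  \prod_(t < m.+1) normal_pdf ((x t *m beta M (h t)) 0 0)
                              (Num.sqrt (sigma2 M (h t))) (y t).

(** A maximum over [K] exists by compactness and is a maximum over [A] by domination; [lne]
    preserves it, being monotone on nonnegative values, with 0 sent to -oo. *)
Lemma attains_sup_lne (R : realType) (T : topologicalType) (f : T -> R)
  (A K : set T) : (forall z, A z -> 0 <= f z) -> K `<=` A -> K !=set0 ->
  compact K -> {within K, continuous f} ->
  (forall z, A z -> exists2 w, K w & f z <= f w) ->
  attains_sup (fun z => lne (f z)%:E) A.
Proof.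
move=> f_ge0 KA K0 K_cpt f_cont K_dom.
have [a /set_mem Ka a_max] := compact_EVT_max K0 K_cpt f_cont.
exists a; first exact: KA.
apply/eqP; rewrite eq_le; apply/andP; split.
  by apply: ereal_sup_ubound; exists a => //; exact: KA.
apply: ge_ereal_sup => _ [z Az <-].
have [w Kw le_zw] := K_dom z Az.
rewrite lee_lne ?in_itv/= ?leey ?lee_fin ?f_ge0//; last exact: KA.
by rewrite (le_trans le_zw)// a_max// inE.
Qed.

(** The remaining weights are nonnegative and do not involve theta. A single theta' that dominates
    the emissions for all [h] therefore dominates the likelihood for every gamma. *)
Lemma attains_sup_loglikelihood (R : realType) (p l m k d : nat)
  (dens : ('I_m.+1 -> 'rV[R]_p) -> R)
  (Theta : 'rV[R]_k -> 'M[R]_(p + 1, l)) (Gamma : 'rV[R]_d -> 'M[R]_l)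
  (y : 'I_m.+1 -> R) (x : 'I_m.+1 -> 'rV[R]_p)
  (T K : set 'rV[R]_k) (G : set 'rV[R]_d) :
  (0 < l)%N -> (forall z, 0 <= dens z) -> G !=set0 -> compact G ->
  {within G, continuous Gamma} ->
  (forall g, G g -> stochastic (Gamma g) /\ irreducible_chain (Gamma g)) ->
  K `<=` T -> K !=set0 -> compact K ->
  (forall i j, continuous (fun theta => Theta theta i j)) ->
  (forall theta j, K theta -> 0 < sigma2 (Theta theta) j) ->
  (forall theta, T theta -> exists2 theta', K theta' &
     forall h, emission y x h (Theta theta) <= emission y x h (Theta theta')) ->
  attains_sup (fun z => loglikelihood dens Theta Gamma y x z.1 z.2) (T `*` G).
Proof.
move=> l_gt0 dens_ge0 [g0 Gg0] G_cpt Gamma_cont Gamma_si KT [th0 Kth0] K_cpt.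
move=> Theta_cont K_pos K_dom.
pose w h g := dens x * stationary_distr (Gamma g) 0 (h ord0)
  * \prod_(s < m) Gamma g (h (widen_ord (leqnSn m) s)) (h (lift ord0 s)).
have w_ge0 h g : G g -> 0 <= w h g.
  move=> /Gamma_si[[P_ge0 _] _].
  by rewrite !mulr_ge0 ?stationary_distr_ge0// prodr_ge0.
apply: (@attains_sup_lne _ _ (fun z => \sum_(h : {ffun 'I_m.+1 -> 'I_l})
    w h z.2 * emission y x h (Theta z.1)) _ (K `*` G)).
- move=> [th g] [_ /= Gg]; apply: sumr_ge0 => h _; rewrite mulr_ge0 ?w_ge0//.
  by apply: prodr_ge0 => t _; exact: normal_pdf_ge0.
- by move=> [th g] [/KT].
- by exists (th0, g0).
- exact: compact_setX.
- apply/subspace_continuousP => -[th g] [/= Kth Gg].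
  set F := within _ _.
  have FF : Filter F by exact: within_filter.
  (* [Gamma] is continuous only relative to [G], so the second projection has to converge within
     [G], not merely to [g]. *)
  have sndF : snd @ F --> within G (nbhs g).
    move=> B; rewrite /within/= => nB.
    have nB' : \forall z \near (th, g), G z.2 -> B z.2.
      exact: (@cvg_snd _ _ (nbhs th) (nbhs g) _ _ nB).
    by apply: (@filterS _ (nbhs (th, g)) _ _ _ _ nB') => -[a b] /= + [_]; exact.
  have fstF : fst @ F --> nbhs th.
    move=> B nB; have nB' : \forall z \near (th, g), B z.1.
      exact: (@cvg_fst _ _ (nbhs th) (nbhs g) _ _ nB).
    by apply: (@filterS _ (nbhs (th, g)) _ _ _ _ nB').
  have Theta_F i j : Theta z.1 i j @[z --> F] --> Theta th i j.
    exact: (cvg_comp fst (fun v => Theta v i j) fstF (Theta_cont i j th)).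
  have Gamma_F i j : Gamma z.2 i j @[z --> F] --> Gamma g i j.
    apply: (cvg_comp snd (fun v => Gamma v i j) sndF).
    have /subspace_continuousP/(_ g Gg) Gamma_g := Gamma_cont.
    exact: (cvg_comp Gamma (fun M : 'M[R]_l => M i j) Gamma_g
      (@coord_continuous _ _ _ i j _)).
  have [g_sto g_irr] := Gamma_si g Gg.
  apply: cvg_big => [|h _]; first exact: add_continuous.
  apply: cvgM.
    apply: cvgM.
      apply: cvgM; first exact: cvg_cst.
      apply: cvg_stationary_distr => //.
      apply: (@filterS _ F _ (K `*` G)); last exact: withinT.
      by move=> [a b] [_ /Gamma_si].
    apply: cvg_big => [|s _]; first exact: mul_continuous.
    exact: Gamma_F.
  apply: cvg_big => [|t _]; first exact: mul_continuous.
  apply: cvg_normal_pdf; first exact: K_pos.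
    rewrite mxE; under eq_cvg do rewrite mxE.
    apply: cvg_big => [|i _]; first exact: add_continuous.
    apply: cvgM; first exact: cvg_cst.
    rewrite !mxE; under eq_cvg do rewrite !mxE.
    exact: Theta_F.
  rewrite /sigma2 mxE; under eq_cvg do rewrite mxE.
  exact: Theta_F.
- move=> [th g] [/= /K_dom[th' Kth' le_th'] Gg]; exists (th', g) => //=.
  by apply: ler_sum => h _; rewrite ler_wpM2l// w_ge0.
Qed.

(** * Parameter vectors made of blocks *)

Lemma block_idxP (l n : nat) (k : 'I_(l * n)) : exists j i, k = block_idx j i.
Proof.
have n_gt0 : (0 < n)%N by case: n k => [[k]|//]; rewrite muln0.
have lt_j : (k %/ n < l)%N by rewrite ltn_divLR.
exists (Ordinal lt_j), (Ordinal (ltn_pmod k n_gt0)).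
by apply: val_inj; rewrite /= -divn_eq.
Qed.

Lemma block_idx_inj (l n : nat) (j j' : 'I_l) (i i' : 'I_n) :
  block_idx j i = block_idx j' i' -> j = j' /\ i = i'.
Proof.
move=> [eq_ji].
have n_gt0 : (0 < n)%N by exact: leq_ltn_trans (ltn_ord i).
have eq_j := congr1 (divn^~ n) eq_ji; have eq_i := congr1 (modn^~ n) eq_ji.
rewrite /= !divnMDl// !divn_small// !addn0 in eq_j.
rewrite /= !modnMDl !modn_small// in eq_i.
by split; apply: val_inj.
Qed.

Lemma block_rowP (T : Type) (l n : nat) (f : 'I_l -> 'I_n -> T) :
  exists v : 'rV[T]_(l * n), forall j i, v 0 (block_idx j i) = f j i.
Proof.
have /choice[g gE] k : exists ji, k = block_idx ji.1 ji.2 :> 'I_(l * n).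
  by have [j [i ->]] := block_idxP k; exists (j, i).
exists (\row_k f (g k).1 (g k).2) => j i; rewrite mxE.
by have /block_idx_inj[<- <-] := gE (block_idx j i).
Qed.

Lemma compact_box (R : realType) (k : nat) (lo hi : 'I_k -> R) :
  compact [set v : 'rV[R]_k | forall i, lo i <= v 0 i <= hi i].
Proof.
rewrite (_ : mkset _ = [set v : 'rV[R]_k |
    forall i, [set` `[lo i, hi i]] (v ord0 i)]).
  apply: (@rV_compact R k (fun i => [set` `[lo i, hi i]])) => i.
  exact: segment_compact.
by apply/seteqP; split=> v /= + i => /(_ i); rewrite in_itv.
Qed.

Lemma beta_Theta_c (R : realType) (p l : nat) (theta : 'rV[R]_(l * (p + 1))) j :
  beta (Theta_c theta) j = \col_i theta 0 (block_idx j (lshift 1 i)).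
Proof. by apply/colP => i; rewrite !mxE. Qed.

Lemma sigma2_Theta_c (R : realType) (p l : nat) (theta : 'rV[R]_(l * (p + 1))) j :
  sigma2 (Theta_c theta) j = theta 0 (block_idx j (rshift p ord0)).
Proof. by rewrite /sigma2 !mxE. Qed.

Lemma beta_Theta_eq (R : realType) (p l : nat) (theta : 'rV[R]_(l * p + 1)) j :
  beta (Theta_eq theta) j = \col_i theta 0 (lshift 1 (block_idx j i)).
Proof. by apply/colP => i; rewrite /beta /Theta_eq col_mxKu !mxE. Qed.

Lemma sigma2_Theta_eq (R : realType) (p l : nat) (theta : 'rV[R]_(l * p + 1)) j :
  sigma2 (Theta_eq theta) j = theta 0 (rshift (l * p) ord0).
Proof. by rewrite /sigma2 /Theta_eq col_mxKd mxE. Qed.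

Lemma continuous_Theta_c (R : realType) (p l : nat) i j :
  continuous (fun theta : 'rV[R]_(l * (p + 1)) => Theta_c theta i j).
Proof.
rewrite (_ : (fun _ => _) = fun theta : 'rV[R]_(l * (p + 1)) =>
    theta 0 (block_idx j i)).
  exact: coord_continuous.
by apply/funext => theta; rewrite mxE.
Qed.

Lemma continuous_Theta_eq (R : realType) (p l : nat) i j :
  continuous (fun theta : 'rV[R]_(l * p + 1) => @Theta_eq R p l theta i j).
Proof.
rewrite -(splitK i); case: (fintype.split i) => i' /=.
  rewrite (_ : (fun _ => _) = fun theta : 'rV[R]_(l * p + 1) =>
    theta 0 (lshift 1 (block_idx j i'))).
    exact: coord_continuous.
  by apply/funext => theta; rewrite /Theta_eq col_mxEu mxE.
rewrite (_ : (fun _ => _) = fun theta : 'rV[R]_(l * p + 1) =>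
    theta 0 (rshift (l * p) ord0)).
  exact: coord_continuous.
by apply/funext => theta; rewrite /Theta_eq col_mxEd mxE.
Qed.

Lemma ler_emission (R : realType) (p l m : nat) (y : 'I_m.+1 -> R)
  (x : 'I_m.+1 -> 'rV[R]_p) (h : {ffun 'I_m.+1 -> 'I_l})
  (M M' : 'M[R]_(p + 1, l)) :
  (forall j t, normal_pdf ((x t *m beta M j) 0 0) (Num.sqrt (sigma2 M j)) (y t)
     <= normal_pdf ((x t *m beta M' j) 0 0) (Num.sqrt (sigma2 M' j)) (y t)) ->
  emission y x h M <= emission y x h M'.
Proof. by move=> le_M; apply: ler_prod => t _; rewrite normal_pdf_ge0 le_M. Qed.

(** * Dominating compact sets for the two parametrizations *)

(** Columns are replaced independently, and each density is compared separately at every t, which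
    handles all [h] at once. *)
Lemma T_c_compact_domination (R : realType) (p l m : nat) (y : 'I_m.+1 -> R)
  (x : 'I_m.+1 -> 'rV[R]_p) (c : R) : 0 < c ->
  exists K : set 'rV[R]_(l * (p + 1)),
    [/\ K `<=` T_c p l c, compact K & forall theta, T_c p l c theta ->
        exists2 theta', K theta' & forall h,
          emission y x h (Theta_c theta) <= emission y x h (Theta_c theta')].
Proof.
move=> c_gt0; pose Y := \sum_t `|y t|.
have le_Y t : `|y t| <= Y by rewrite /Y (bigD1 t)//= lerDl sumr_ge0.
have [B B_ge0 B_dom] := residual_domination y x.
have [S S_ge S_dom] := normal_pdf_large_variance Y c_gt0.
pose D := Num.max B S.
(* Variance coordinates start at [c], so the box stays inside the parameter space; coefficient
   coordinates start at [- D]. *)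
pose lo (k : 'I_(l * (p + 1))) :=
  if [exists j : 'I_l, k == block_idx j (rshift p ord0)] then c else - D.
exists [set theta | forall k, (lo k : R) <= theta 0 k <= D]; split.
- move=> theta /= th_box j; have /andP[+ _] := th_box (block_idx j (rshift p ord0)).
  by rewrite /lo; case: existsP => // -[]; exists j.
- exact: compact_box.
move=> theta th_T.
have /choice[bs bsP] j : exists bs : 'cV[R]_p * R,
    [/\ forall i, `|bs.1 i 0| <= B, c <= bs.2 <= S & forall t,
      normal_pdf ((x t *m beta (Theta_c theta) j) 0 0)
        (Num.sqrt (sigma2 (Theta_c theta) j)) (y t)
      <= normal_pdf ((x t *m bs.1) 0 0) (Num.sqrt bs.2) (y t)].
  rewrite sigma2_Theta_c; set s := theta 0 _.
  have s_ge : c <= s := th_T j.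
  (* A moderate variance is kept and only the coefficients change; a large one is replaced by [c]
     together with zero coefficients. *)
  have [s_le|s_gt] := leP s S.
    have [b' b'_le b'_dom] := B_dom (beta (Theta_c theta) j).
    exists (b', s); split=> //=; first exact/andP.
    by move=> t; rewrite ler_normal_pdf_residual// (lt_le_trans c_gt0).
  exists (0, c); split=> /=; [by move=> i; rewrite mxE normr0|by rewrite lexx|].
  move=> t; have -> : (x t *m (0 : 'cV[R]_p)) 0 0 = 0 by rewrite mulmx0 mxE.
  exact: S_dom.
pose f j (i : 'I_(p + 1)) := match fintype.split i with
  inl i' => (bs j).1 i' 0 | inr _ => (bs j).2 end.
have [theta' th'E] := block_rowP f.
have th'_l j i : theta' 0 (block_idx j (lshift 1 i)) = (bs j).1 i 0.
  by rewrite th'E /f (unsplitK (inl i)).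
have th'_r j : theta' 0 (block_idx j (rshift p ord0)) = (bs j).2.
  by rewrite th'E /f (unsplitK (inr ord0)).
have beta' j : beta (Theta_c theta') j = (bs j).1.
  by rewrite beta_Theta_c; apply/colP => i; rewrite mxE th'_l.
have sigma2' j : sigma2 (Theta_c theta') j = (bs j).2.
  by rewrite sigma2_Theta_c th'_r.
exists theta' => [k|h]; last first.
  apply: ler_emission => j t; rewrite beta' sigma2'.
  by have [_ _] := bsP j.
have [j [i ->]] := block_idxP k; have [b_le /andP[s_ge s_le] _] := bsP j.
rewrite /lo; case: existsP => [[j' /eqP/block_idx_inj[_ ->]]|].
  by rewrite th'_r s_ge le_max s_le orbT.
rewrite -(splitK i); case: (fintype.split i) => i' /= no_j.
  by rewrite th'_l -ler_norml le_max b_le.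
by case: no_j; exists j; rewrite (ord1 i').
Qed.

(** For a small common variance a single density may be huge where its residual vanishes, so the
    comparison is made on the whole product, where some residual is at least [e]. *)
Lemma T_eq_compact_domination (R : realType) (p l m : nat) (y : 'I_m.+1 -> R)
  (x : 'I_m.+1 -> 'rV[R]_p) : ~ in_union_hyperplanes l y x ->
  exists K : set 'rV[R]_(l * p + 1),
    [/\ K `<=` T_eq R p l, compact K & forall theta, T_eq R p l theta ->
        exists2 theta', K theta' & forall h,
          emission y x h (@Theta_eq R p l theta)
            <= emission y x h (@Theta_eq R p l theta')].
Proof.
move=> generic; pose Y := \sum_t `|y t|.
have le_Y t : `|y t| <= Y by rewrite /Y (bigD1 t)//= lerDl sumr_ge0.
have [B B_ge0 B_dom] := residual_domination y x.
have [S S_ge1 S_dom] := normal_pdf_large_variance Y (@ltr01 R).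
have [e e_gt0 e_gap] := assignment_residual_gap generic.
have [r r_gt0 r_dom] := normal_pdf_small_variance m Y e_gt0.
(* The minimum with 1 keeps the replacement variance 1 inside the box. *)
pose D := Num.max B S; pose r1 := Num.min r 1.
have r1_gt0 : 0 < r1 by rewrite lt_min r_gt0 ltr01.
pose last : 'I_(l * p + 1) := rshift (l * p) ord0.
pose lo k := if k == last then r1 else - D.
exists [set theta | forall k, (lo k : R) <= theta 0 k <= D]; split.
- move=> theta /(_ last) /andP[+ _]; rewrite /lo eqxx; exact: lt_le_trans.
- exact: compact_box.
move=> theta th_T; set s := theta 0 last; have s_gt0 : 0 < s := th_T.
have box (b : 'I_l -> 'cV[R]_p) (s' : R) : (forall j i, `|b j i 0| <= B) ->
    r1 <= s' -> s' <= S -> exists2 theta' : 'rV[R]_(l * p + 1),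
      (forall k, lo k <= theta' 0 k <= D) &
      (forall j, beta (Theta_eq theta') j = b j) /\
      (forall j : 'I_l, sigma2 (@Theta_eq R p l theta') j = s').
  move=> b_le s'_ge s'_le; have [v vE] := block_rowP (fun j i => b j i 0).
  exists (row_mx v (const_mx s')) => [k|].
    rewrite -(splitK k); case: (fintype.split k) => k' /=.
      rewrite row_mxEl /lo eq_lrshift; have [j [i ->]] := block_idxP k'.
      by rewrite vE -ler_norml le_max b_le.
    by rewrite row_mxEr mxE /lo (ord1 k') eqxx s'_ge le_max s'_le orbT.
  split=> j; last by rewrite sigma2_Theta_eq row_mxEr mxE.
  by rewrite beta_Theta_eq; apply/colP => i; rewrite mxE row_mxEl vE.
have [/andP[s_ge s_le]|s_out] := boolP (r1 <= s <= S).
  have /choice[b bP] j : exists b : 'cV[R]_p, (forall i, `|b i 0| <= B) /\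
      forall t, `|y t - (x t *m b) 0 0|
        <= `|y t - (x t *m beta (@Theta_eq R p l theta) j) 0 0|.
    by have [b ? ?] := B_dom (beta (@Theta_eq R p l theta) j); exists b.
  have [|//|//|theta' th'_box [beta' sigma2']] := box b s.
    by move=> j i; have [] := bP j.
  exists theta' => // h; apply: ler_emission => j t.
  rewrite beta' sigma2' sigma2_Theta_eq ler_normal_pdf_residual//.
  by have [_] := bP j.
have [||//|theta' th'_box [beta' sigma2']] := box (fun=> 0) 1.
- by move=> j i; rewrite mxE normr0.
- by rewrite ge_min lexx orbT.
exists theta' => // h.
have -> : emission y x h (Theta_eq theta')
    = \prod_t normal_pdf 0 (Num.sqrt 1) (y t).
  by apply: eq_bigr => t _; rewrite beta' sigma2' mulmx0 mxE.
have -> : emission y x h (Theta_eq theta) = \prod_t normal_pdf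
    ((x t *m beta (Theta_eq theta) (h t)) 0 0) (Num.sqrt s) (y t).
  by apply: eq_bigr => t _; rewrite sigma2_Theta_eq.
(* Zero coefficients with variance 1 serve both cases: a small variance is handled through the
   product over t, a large one factor by factor. *)
move: s_out; rewrite negb_and -!ltNge => /orP[s_lt|s_gt].
  have s_lt_r : s < r by rewrite (lt_le_trans s_lt)// ge_min lexx.
  exact: (r_dom s (fun t => (x t *m beta (Theta_eq theta) (h t)) 0 0) y
            s_gt0 s_lt_r (e_gap h _) le_Y).
by apply: ler_prod => t _; rewrite normal_pdf_ge0 S_dom.
Qed.

Theorem theorem1 (R : realType) (p l m d : nat)
  (p_ge1 : (1 <= p)%N) (l_ge2 : (2 <= l)%N)
  (y : 'I_m.+1 -> R) (x : 'I_m.+1 -> 'rV[R]_p)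
  (data_generic : ~ in_union_hyperplanes l y x)
  (dens : ('I_m.+1 -> 'rV[R]_p) -> R) (dens_ge0 : forall z, 0 <= dens z)
  (G : set 'rV[R]_d) (G_neq0 : G !=set0) (G_compact : compact G)
  (Gamma : 'rV[R]_d -> 'M[R]_l)
  (Gamma_continuous : {within G, continuous Gamma})
  (Gamma_transition : forall gamma, G gamma ->
     [/\ stochastic (Gamma gamma), irreducible_chain (Gamma gamma)
       & aperiodic_chain (Gamma gamma)]) :
  (forall c : R, 0 < c ->
     attains_sup
       (fun z => loglikelihood dens (@Theta_c R p l) Gamma y x z.1 z.2)
       (T_c p l c `*` G))
  /\
  attains_sup
    (fun z => loglikelihood dens (@Theta_eq R p l) Gamma y x z.1 z.2)
    (T_eq R p l `*` G).
Proof.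
have l_gt0 : (0 < l)%N by exact: ltnW.
have Gamma_si g : G g -> stochastic (Gamma g) /\ irreducible_chain (Gamma g).
  by case/Gamma_transition.
split=> [c c_gt0|].
  have [K [KT K_cpt K_dom]] := T_c_compact_domination l y x c_gt0.
  apply: (@attains_sup_loglikelihood _ _ _ _ _ _ _ _ _ _ _ _ K) => //.
  (* Dominating any one admissible parameter shows that [K] is nonempty. *)
  - have [|th Kth _] := K_dom (const_mx c); last by exists th.
    by move=> j; rewrite mxE.
  - exact: continuous_Theta_c.
  - by move=> th j /KT /(_ j); rewrite sigma2_Theta_c; exact: lt_le_trans.
have [K [KT K_cpt K_dom]] := T_eq_compact_domination data_generic.
apply: (@attains_sup_loglikelihood _ _ _ _ _ _ _ _ _ _ _ _ K) => //.
- have [|th Kth _] := K_dom (const_mx 1); last by exists th.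
  by rewrite /T_eq /= mxE.
- exact: continuous_Theta_eq.
- by move=> th j /KT; rewrite sigma2_Theta_eq.
Qed.
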